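(* Let $\mathcal{X}\subset\mathbb{R}^n$ be open and bounded and let $k\geq n+1$. Then the set of Morse functions $$M:=\left\{\Psi\in C^k(\bar{\mathcal{X}},\mathbb{R}):\ \Psi|_{\mathcal{X}}\text{ is a Morse function}\right\}$$ is a dense subset of the Banach space $\left(C^k(\bar{\mathcal{X}},\mathbb{R}),\|\cdot\|_{C^k(\bar{\mathcal{X}})}\right)$.
   Context: $\bar{\mathcal{X}}$ denotes the closure of $\mathcal{X}$. For $k\in\mathbb{N}_0$, $C^k(\bar{\mathcal{X}},\mathbb{R})$ is the vector space of all $\Psi\in C^k(\mathcal{X},\mathbb{R})$ such that all partial derivatives of $\Psi$ of order at most $k$ extend continuously to $\bar{\mathcal{X}}$, endowed with the norm $\|\Psi\|_{C^k(\bar{\mathcal{X}})}:=\sum_{|s|\leq k}\|\partial^s\Psi\|_\infty$ (sum over multi-indices $s$), where $\|f\|_\infty:=\sup_{x\in\mathcal{X}}|f(x)|$. A map $\Psi\in C^2(\mathcal{X},\mathbb{R})$ with $\mathcal{X}\subset\mathbb{R}^n$ open is called a Morse function if all its critical points are non-degenerate, i.e. for every $p\in\mathcal{X}$ with $\nabla\Psi(p)=0$ the Hessian matrix $H_\Psi(p)$ is non-singular (a function without critical points is a Morse function). *)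

(* Defs.v *)
From HB Require Import structures.
From mathcomp Require Import all_boot all_order all_algebra.
From mathcomp Require Import all_classical all_reals all_analysis.

Set Implicit Arguments.
Unset Strict Implicit.
Unset Printing Implicit Defensive.
Import Order.TTheory GRing.Theory Num.Theory.
Import numFieldNormedType.Exports.

Local Open Scope classical_set_scope.
Local Open Scope ring_scope.

(* Entries up to [k] suffice: only multi-indices of degree at most [k] are used. *)
Definition multi_index (n k : nat) := {ffun 'I_n -> 'I_k.+1}.

Definition degree n k (a : multi_index n k) : nat := (\sum_i a i)%N.

Definition seq_of_multi_index n k (a : multi_index n k) : seq 'I_n :=
  flatten [seq nseq (a i) i | i <- enum 'I_n].

Lemma size_seq_of_multi_index n k (a : multi_index n k) :
  size (seq_of_multi_index a) = degree a.
Proof.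
rewrite size_flatten /shape -map_comp sumnE big_map enumT.
by apply: eq_bigr => i _ /=; rewrite size_nseq.
Qed.

Section partial_derivatives.
Context {R : realType} {n : nat}.
Implicit Types (f g : 'rV[R]_n -> R) (X : set 'rV[R]_n).

Definition pderiv (i : 'I_n) f : 'rV[R]_n -> R := 'D_('e_i) f.

(* [pderivs [:: i1; ...; ir] f] is d_i1 (d_i2 (... (d_ir f))). *)
Definition pderivs (s : seq 'I_n) f : 'rV[R]_n -> R := foldr pderiv f s.

Definition gradient f (p : 'rV[R]_n) : 'rV[R]_n := \row_i pderiv i f p.

Definition hessian f (p : 'rV[R]_n) : 'M[R]_n :=
  \matrix_(i, j) pderiv i (pderiv j f) p.

(* The total function [f] stands for its restriction to the open set [X]: none
   of the conditions below depends on the values of [f] outside [X]. *)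
Definition Ck X (k : nat) f : Prop :=
  (forall (s : seq 'I_n) (i : 'I_n), (size s < k)%N ->
     forall x, X x -> derivable (pderivs s f) x 'e_i) /\
  (forall s : seq 'I_n, (size s <= k)%N ->
     forall x, X x -> {for x, continuous (pderivs s f)}).

Definition extends_continuously X f : Prop :=
  exists2 g : 'rV[R]_n -> R,
    {within closure X, continuous g} & forall x, X x -> g x = f x.

Definition Ck_closure X (k : nat) f : Prop :=
  Ck X k f /\
  forall s : seq 'I_n, (size s <= k)%N -> extends_continuously X (pderivs s f).

Definition morse X f : Prop :=
  Ck X 2 f /\
  forall p, X p -> gradient f p = 0 -> hessian f p \in unitmx.

Definition mderiv (k : nat) (a : multi_index n k) f : 'rV[R]_n -> R :=
  pderivs (seq_of_multi_index a) f.

(* [sup] is the real-valued supremum: it is 0 on the empty set, and on sets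
   that are not bounded above, which do not occur below. *)
Definition sup_norm X f : R := sup [set `|f x| | x in X].

Definition Ck_norm X (k : nat) f : R :=
  \sum_(a : multi_index n k | (degree a <= k)%N) sup_norm X (mderiv a f).

End partial_derivatives.

Section Ck_theory.
Context {R : realType} {n : nat}.
Variable X : set 'rV[R]_n.
Hypothesis oX : open X.
Implicit Types (f g : 'rV[R]_n -> R).

Let eqX f g := forall x, X x -> f x = g x.

Let eqX_near f g x : eqX f g -> X x -> \forall y \near x, f y = g y.
Proof.
move=> fg Xx; have : nbhs x X by exact: open_nbhs_nbhs.
by apply: filterS => y; exact: fg.
Qed.

Let eqX_derivable f g x v : eqX f g -> X x -> derivable f x v -> derivable g x v.
Proof. by move=> fg Xx; apply: (near_eq_derivable (eqX_near fg Xx)). Qed.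

Let eqX_continuous f g x : eqX f g -> X x ->
  {for x, continuous f} -> {for x, continuous g}.
Proof.
move=> fg Xx cf; rewrite /prop_for /continuous_at -(fg _ Xx).
apply: cvg_trans cf; exact: (near_eq_cvg (eqX_near fg Xx)).
Qed.

Let eqX_pderiv f g i : eqX f g -> eqX (pderiv i f) (pderiv i g).
Proof. by move=> fg x Xx; exact: (near_eq_derive _ (eqX_near fg Xx)). Qed.

Lemma pderivs0 (s : seq 'I_n) : pderivs s (0 : 'rV[R]_n -> R) = 0.
Proof.
elim: s => //= i s ->; rewrite /pderiv; apply/funext => x.
by rewrite -[0]/(cst 0) derive_cst.
Qed.

Lemma pderivs_lin k (a : R) f g (s : seq 'I_n) :
    Ck X k f -> Ck X k g -> (size s <= k)%N ->
  forall x, X x -> pderivs s (a *: f + g) x = a * pderivs s f x + pderivs s g x.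
Proof.
move=> [df _] [dg _]; elim: s => [//|i s ih] /= sk x Xx.
have /eqX_pderiv -> // : eqX (pderivs s (a *: f + g))
  (a *: pderivs s f + pderivs s g) by apply: ih; exact: ltnW.
have Df : derivable (pderivs s f) x 'e_i by exact: df.
by rewrite /pderiv deriveD ?deriveZ//; [exact: derivableZ|exact: dg].
Qed.

Lemma Ck_lin k (a : R) f g : Ck X k f -> Ck X k g -> Ck X k (a *: f + g).
Proof.
move=> Cf Cg; have := pderivs_lin a Cf Cg => E.
case: Cf Cg => [df cf] [dg cg]; split=> [s i sk x Xx|s sk x Xx].
- have Es : eqX (a *: pderivs s f + pderivs s g) (pderivs s (a *: f + g)).
    by move=> y Xy; rewrite (E s (ltnW sk) y Xy).
  apply: (eqX_derivable Es Xx).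
  exact: (derivableD (derivableZ (df s i sk x Xx)) (dg s i sk x Xx)).
- have Es : eqX (a *: pderivs s f + pderivs s g) (pderivs s (a *: f + g)).
    by move=> y Xy; rewrite (E s sk y Xy).
  apply: (eqX_continuous Es Xx).
  exact: (continuousD (continuousZl_tmp (cf s sk x Xx)) (cg s sk x Xx)).
Qed.

Lemma Ck_closure_lin k (a : R) f g :
  Ck_closure X k f -> Ck_closure X k g -> Ck_closure X k (a *: f + g).
Proof.
move=> [Cf ef] [Cg eg]; split; first exact: Ck_lin.
move=> s sk; have [F cF FE] := ef _ sk; have [G cG GE] := eg _ sk.
exists (a *: F + G); last first.
  by move=> x Xx; rewrite (pderivs_lin a Cf Cg)// -FE// -GE.
move=> x; exact: (continuousD (continuousZl_tmp (cF x)) (cG x)).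
Qed.

Lemma Ck_closure0 k : Ck_closure X k 0.
Proof.
split; first split.
- by move=> s i _ x _; rewrite pderivs0; exact: derivable_cst.
- by move=> s _ x _; rewrite pderivs0; exact: cst_continuous.
- by move=> s _; exists 0; [move=> x; exact: cst_continuous|rewrite pderivs0].
Qed.

Hypothesis bX : bounded_set X.

Lemma compact_closure_bounded : compact (closure X).
Proof.
apply: bounded_closed_compact; last exact: closed_closure.
have [M [Mr HM]] := bX.
have XM x : closure X x -> `|x| <= `|M| + 1 + 1.
  move=> /(_ _ (nbhsx_ballx x 1 ltr01))[y [Xy]].
  rewrite -ball_normE/= => /ltW xy.
  rewrite -(subrK y x) addrC (le_trans (ler_normD _ _))// lerD//.
  by apply: HM Xy; rewrite (le_lt_trans (ler_norm _))// ltrDl.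
exists (`|M| + 1 + 1); split; first exact: num_real.
by move=> y My x /XM /le_trans; apply; exact: ltW.
Qed.

Lemma extends_continuously_bounded f : extends_continuously X f ->
  exists M, forall x, X x -> `|f x| <= M.
Proof.
move=> [g cg gf].
have [M [Mr HM]] := compact_bounded
  (continuous_compact cg compact_closure_bounded).
exists (`|M| + 1) => x Xx; rewrite -gf//; apply: (HM (`|M| + 1)).
  by rewrite (le_lt_trans (ler_norm _))// ltrDl.
by exists x => //; exact: subset_closure.
Qed.

Lemma sup_norm_ub f x : extends_continuously X f -> X x ->
  `|f x| <= sup_norm X f.
Proof.
move=> /extends_continuously_bounded[M HM] Xx; apply: ub_le_sup; last by exists x.
by exists M => _ [y Xy <-]; exact: HM.
Qed.

Lemma sup_norm_le f (M : R) : 0 <= M -> (forall x, X x -> `|f x| <= M) ->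
  sup_norm X f <= M.
Proof.
move=> M0 HM; have [->|/set0P[x Xx]] := eqVneq X set0.
  by rewrite /sup_norm image_set0 sup0.
by apply: ge_sup; [exists `|f x|, x|move=> _ [y Xy <-]; exact: HM].
Qed.

Lemma sup_norm_ge0 f : 0 <= sup_norm X f.
Proof.
rewrite /sup_norm; set S := (X in sup X).
have [[[y [x Xx _]] ubS]|/sup_out->//] := pselect (has_sup S).
by apply: (le_trans (normr_ge0 (f x))); apply: ub_le_sup => //; exists x.
Qed.

Lemma Ck_normD k f g : Ck_closure X k f -> Ck_closure X k g ->
  Ck_norm X k (f + g) <= Ck_norm X k f + Ck_norm X k g.
Proof.
move=> [Cf ef] [Cg eg]; rewrite /Ck_norm -big_split/=.
apply: ler_sum => a ak; rewrite -size_seq_of_multi_index in ak.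
apply: sup_norm_le; first by rewrite addr_ge0// sup_norm_ge0.
move=> x Xx; rewrite -[f in mderiv _ (f + g)]scale1r /mderiv.
rewrite (pderivs_lin 1 Cf Cg)// mul1r (le_trans (ler_normD _ _))//.
by rewrite lerD// sup_norm_ub//; [exact: ef|exact: eg].
Qed.

Lemma Ck_normZ k (a : R) f : Ck_closure X k f ->
  Ck_norm X k (a *: f) = `|a| * Ck_norm X k f.
Proof.
move=> Cf.
have C0 := Ck_closure0 k.
have E (s : seq 'I_n) : (size s <= k)%N ->
    forall x, X x -> pderivs s (a *: f) x = a * pderivs s f x.
  move=> sk x Xx; rewrite -[a *: f]addr0 (pderivs_lin a Cf.1 C0.1)//.
  by rewrite pderivs0 addr0.
rewrite /Ck_norm mulr_sumr; apply: eq_bigr => b.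
rewrite -size_seq_of_multi_index => bk.
have ef : extends_continuously X (mderiv b f) by exact: Cf.2.
apply/eqP; rewrite eq_le; apply/andP; split.
  apply: sup_norm_le => [|x Xx]; first by rewrite mulr_ge0// sup_norm_ge0.
  by rewrite /mderiv E// normrM ler_wpM2l// sup_norm_ub.
have [->|a0] := eqVneq a 0; first by rewrite normr0 mul0r sup_norm_ge0.
rewrite -ler_pdivlMl ?normr_gt0//.
apply: sup_norm_le => [|x Xx].
  by rewrite mulr_ge0 ?invr_ge0// sup_norm_ge0.
rewrite ler_pdivlMl ?normr_gt0// -normrM -E//.
apply: sup_norm_ub => //.
by have [_] := Ck_closure_lin a Cf C0; rewrite addr0; exact.
Qed.

Lemma Ck_norm_eq0 k f : Ck_closure X k f -> Ck_norm X k f = 0 ->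
  forall x, X x -> f x = 0.
Proof.
move=> [_ ef] /eqP; rewrite psumr_eq0; last by move=> a _; exact: sup_norm_ge0.
move=> /allP /(_ [ffun=> ord0] (mem_index_enum _)).
have d0 : degree ([ffun=> ord0] : multi_index n k) = 0%N.
  by rewrite /degree big1// => i _; rewrite ffunE.
rewrite d0 leq0n/= => /eqP N0 x Xx; apply/eqP; rewrite -normr_le0 -N0.
have -> : mderiv ([ffun=> ord0] : multi_index n k) f = f.
  by rewrite /mderiv (size0nil (etrans (size_seq_of_multi_index _) d0)).
by apply: sup_norm_ub => //; exact: (ef [::]).
Qed.

End Ck_theory.

Section Ck_space.
Context {R : realType} {n : nat}.
Variables (X : set 'rV[R]_n) (k : nat).

(* An element of C^k(closure X) is represented by its extension by 0 outside
   [X], so that equality of elements is equality of functions on [X]. Openness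
   and boundedness are parameters of the type because the vector space structure
   needs the former and the norm (finite suprema) the latter. *)
Definition Ck_space_pred (oX : open X) : {pred 'rV[R]_n -> R} :=
  [pred f | `[< Ck_closure X k f /\ forall x, ~ X x -> f x = 0 >]].

Record Ck_space (oX : open X) (bX : bounded_set X) := CkSpace {
  Ck_space_fun :> 'rV[R]_n -> R;
  Ck_space_funP : Ck_space_fun \in Ck_space_pred oX }.

Variables (oX : open X) (bX : bounded_set X).

Lemma Ck_space_submod_closed : submod_closed (Ck_space_pred oX).
Proof.
split; first by apply/asboolP; split=> //; exact: Ck_closure0.
move=> a f g /asboolP[Cf f0] /asboolP[Cg g0]; apply/asboolP; split.
  exact: Ck_closure_lin.
by move=> x nXx; rewrite -[LHS]/(a * f x + g x) f0// g0// mulr0 addr0.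
Qed.

HB.instance Definition _ := GRing.isSubmodClosed.Build R _ (Ck_space_pred oX)
  Ck_space_submod_closed.

Local Notation ty := (Ck_space oX bX).

HB.instance Definition _ := [isSub for (@Ck_space_fun oX bX)].
HB.instance Definition _ := [Choice of ty by <:].
HB.instance Definition _ := [SubChoice_isSubLmodule of ty by <:].

Lemma Ck_spaceP (f : ty) : Ck_closure X k f.
Proof. by have /asboolP[] := Ck_space_funP f. Qed.

Lemma Ck_space_out (f : ty) x : ~ X x -> f x = 0.
Proof. by have /asboolP[_] := Ck_space_funP f; exact. Qed.

Let nrm (f : ty) : R := Ck_norm X k f.

Let nrmD (f g : ty) : nrm (f + g) <= nrm f + nrm g.
Proof. exact: Ck_normD (Ck_spaceP f) (Ck_spaceP g). Qed.

Let nrmZ (a : R) (f : ty) : nrm (a *: f) = `|a| * nrm f.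
Proof. exact: Ck_normZ (Ck_spaceP f). Qed.

Let nrm0 (f : ty) : nrm f = 0 -> f = 0.
Proof.
move=> /(Ck_norm_eq0 bX (Ck_spaceP f)) f0; apply/val_inj/funext => x /=.
by have [Xx|nXx] := pselect (X x); [exact: f0|exact: Ck_space_out].
Qed.

HB.instance Definition _ := Lmodule_isNormed.Build R ty nrmD nrmZ nrm0.

Lemma Ck_space_normE (f : ty) : `|f| = Ck_norm X k f.
Proof. by []. Qed.

Definition morse_functions : set ty := [set f | morse X f].

End Ck_space.

Arguments morse_functions {R n X} k oX bX _.

(* Main.v *)
From HB Require Import structures.
Require Import Defs.
From mathcomp Require Import all_boot all_order all_algebra.
From mathcomp Require Import all_classical all_reals all_analysis.
From mathcomp Require Import ring lra zify.

(** Let [f] be an element of C^k of the closure of [X], with [k >= 2]. For a row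
    vector [a], the function [x |-> f x - \sum_i a_i x_i] has the same Hessian as
    [f], and its critical points are the points where the gradient of [f] is [a].
    It is therefore a Morse function as soon as [a] is a regular value of the
    gradient map of [f], and it is close to [f] when [a] is small
    ([linear_Ck_small], [perturb_morse]). It remains to find arbitrarily small
    regular values, that is, to prove Sard's theorem for a C^1 map between open
    subsets of spaces of the same dimension ([regular_values_dense]).

    On a closed cube contained in [X] the critical values form a compact set, and
    by a volume argument this set has empty interior ([critical_values_codense]):
    cut the cube into small cells of side [h]; the image of a cell that contains a
    critical point has diameter O(h) and, by [critical_slab], lies in a slab of
    thickness o(h) around a hyperplane. Volumes are measured by counting the
    points of a fine grid in a slab ([counting_separated_cells]). Finally, the
    open set [X] is a countable union of such cubes, and Baire's theorem shows
    that the values regular on all of them are dense. *)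

Set Implicit Arguments.
Unset Strict Implicit.
Unset Printing Implicit Defensive.
Import Order.TTheory GRing.Theory Num.Theory.
Import numFieldNormedType.Exports.
Local Open Scope classical_set_scope.
Local Open Scope ring_scope.

(** * Coordinatewise estimates in row vectors *)

Section RowVectors.
Context {R : realType} {n : nat}.
Implicit Types x y p c : 'rV[R]_n.

Lemma rV_norm_le x (e : R) : 0 <= e -> (forall i, `|x 0 i| <= e) -> `|x| <= e.
Proof.
move=> e0 xe; rewrite /Num.norm/= mx_normrE.
by apply/bigmax_leP; split=> // -[i j] _ /=; rewrite (ord1 i).
Qed.

Lemma rV_coord_le x i : `|x 0 i| <= `|x|.
Proof.
rewrite [leRHS]/Num.norm/= mx_normrE.
by apply/bigmax_geP; right; exists (0, i).
Qed.

(** The coordinate box spanned by [p] and [x]: all corners of the axis-parallel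
    path from [p] to [x] lie in it, which makes it a substitute for the segment
    when only partial derivatives are available. *)
Definition box x p : set 'rV[R]_n :=
  [set y | forall i,
    Num.min (p 0 i) (x 0 i) <= y 0 i <= Num.max (p 0 i) (x 0 i)].

(** For the sup norm, balls are cubes and hence contain the box of any two of
    their points. With [c := x] and [r := `|p - x|] this also says that no point
    of the box is farther from [x] than [p] is. *)
Lemma box_ball c (r : R) x p y :
  `|x - c| <= r -> `|p - c| <= r -> box x p y -> `|y - c| <= r.
Proof.
move=> xc pc xpy; apply: rV_norm_le => [|i].
  exact: le_trans (normr_ge0 _) xc.
have := le_trans (rV_coord_le _ i) xc; have := le_trans (rV_coord_le _ i) pc.
rewrite !mxE !ler_norml => /andP[? ?] /andP[? ?].
by have := xpy i; rewrite ge_min le_max => /andP[/orP[?|?] /orP[?|?]]; lra.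
Qed.

(** The one-dimensional mean value theorem along the direction ['e_j]. *)
Lemma increment_line (f : 'rV[R]_n -> R) (j : 'I_n) y (a b D : R) : a <= b ->
    (forall s, a <= s <= b -> derivable f (s *: 'e_j + y) 'e_j /\
       `|'D_('e_j) f (s *: 'e_j + y)| <= D) ->
  `|f (b *: 'e_j + y) - f (a *: 'e_j + y)| <= D * (b - a).
Proof.
move=> ab Hf; pose g (s : R) := f (s *: 'e_j + y).
have dg s : a <= s <= b -> is_derive s (1 : R) g ('D_('e_j) f (s *: 'e_j + y)).
  move=> /Hf [df _].
  have E : (fun h : R => h^-1 *: ((g \o shift s) (h *: (1 : R)) - g s)) =
      (fun h : R => h^-1 *: ((f \o shift (s *: 'e_j + y)) (h *: 'e_j)
                             - f (s *: 'e_j + y))).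
    apply/funext => h /=; congr (_ *: (_ - _)); rewrite /g; congr f.
    by rewrite [_%:A]mulr1 scalerDl addrA.
  by split; rewrite /derivable /derive E.
have cg : {within `[a, b], continuous g}.
  by apply: derivable_within_continuous => s sab; have [] := dg s sab.
have dg' s : s \in `]a, b[ ->
    is_derive s (1 : R) g ('D_('e_j) f (s *: 'e_j + y)).
  by rewrite in_itv/= => /andP[? ?]; apply: dg; rewrite !ltW.
have [s sab ->] := MVT_segment ab dg' cg.
rewrite normrM [`|b - a|]ger0_norm ?subr_ge0// ler_wpM2r ?subr_ge0//.
by have [] := Hf s sab.
Qed.

(** Changing the coordinates one at a time leads from [p] to [x] in [n] steps,
    each controlled by a single partial derivative. *)
Lemma increment_box (f : 'rV[R]_n -> R) x p (D : R) : 0 <= D ->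
    (forall y j, box x p y ->
       derivable f y 'e_j /\ `|'D_('e_j) f y| <= D) ->
  `|f x - f p| <= n%:R * D * `|x - p|.
Proof.
move=> D0 Hf.
pose w k : 'rV[R]_n := \row_i (if (i < k)%N then x 0 i else p 0 i).
have w0 : w 0%N = p by apply/rowP => i; rewrite mxE.
have wn : w n = x by apply/rowP => i; rewrite mxE ltn_ord.
have step (j : 'I_n) : `|f (w j.+1) - f (w j)| <= D * `|x - p|.
  pose y : 'rV[R]_n := \row_i (if i == j then 0 else w j 0 i).
  have E s : s *: 'e_j + y = \row_i (if i == j then s else w j 0 i).
    apply/rowP => i; rewrite !mxE eqxx/=.
    by case: (i == j); rewrite ?mulr1 ?mulr0 ?addr0 ?add0r.
  have Ep : w j = p 0 j *: 'e_j + y.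
    rewrite E; apply/rowP => i; rewrite !mxE.
    by case: eqVneq => [->|//]; rewrite ltnn.
  have Ex : w j.+1 = x 0 j *: 'e_j + y.
    rewrite E; apply/rowP => i; rewrite !mxE ltnS leq_eqVlt.
    by case: (eqVneq i j) => [->|ij];
      rewrite ?eqxx // (negPf (_ : val i != val j)).
  have Hb s : Num.min (p 0 j) (x 0 j) <= s <= Num.max (p 0 j) (x 0 j) ->
      box x p (s *: 'e_j + y).
    move=> sb i; rewrite E !mxE; case: eqVneq => [->//|_].
    by case: ifP => _; rewrite ge_min le_max lexx ?orbT.
  have Hxp : `|x 0 j - p 0 j| <= `|x - p|.
    by apply: le_trans (rV_coord_le _ j); rewrite !mxE.
  rewrite Ep Ex; have [px|/ltW xp] := leP (p 0 j) (x 0 j).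
  - apply: (le_trans (@increment_line f j y (p 0 j) (x 0 j) D px _)).
      move=> s sb; apply: Hf; apply: Hb.
      by rewrite (min_idPl px) (max_idPr px).
    by rewrite ler_wpM2l// (le_trans (ler_norm _)).
  - rewrite distrC.
    apply: (le_trans (@increment_line f j y (x 0 j) (p 0 j) D xp _)).
      move=> s sb; apply: Hf; apply: Hb.
      by rewrite (min_idPr xp) (max_idPl xp).
    by rewrite ler_wpM2l// (le_trans (ler_norm _))// distrC.
rewrite -{1}wn -{1}w0 -(telescope_sumr (f \o w))// big_mkord.
apply: (le_trans (ler_norm_sum _ _ _)).
apply: (le_trans (ler_sum _ (fun j _ => step j))).
by rewrite sumr_const card_ord -mulrA mulr_natl.
Qed.

(** Heine-Cantor; as [f] is continuous at the points of [K] along the whole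
    space, the modulus is valid also for [y] outside [K]. *)
Lemma unif_continuous_compact (K : set 'rV[R]_n) (f : 'rV[R]_n -> R) (e : R) :
  compact K -> (forall x, K x -> {for x, continuous f}) -> 0 < e ->
  \forall d \near 0^'+, forall x, K x -> forall y, `|x - y| < d ->
    `|f x - f y| < e.
Proof.
move=> /compact_near_coveringP cK cf e0; apply: cK => x Kx.
have e2 : 0 < e / 2 by rewrite divr_gt0.
have /cvgrPdist_lt/(_ _ e2)/nbhs_ballP[r /= r0 Hr] := cf x Kx.
exists (ball x (r / 2), [set d | d < r / 2]) => /=.
  split; first by apply: nbhsx_ballx; rewrite divr_gt0.
  by apply: nbhs_right_lt; rewrite divr_gt0.
move=> [x' d] /= [xx' dr] y x'y.
rewrite -ball_normE/= in xx'.
have h1 : `|f x - f x'| < e / 2.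
  by apply: Hr; rewrite -ball_normE/= (lt_le_trans xx')//; lra.
have h2 : `|f x - f y| < e / 2.
  apply: Hr; rewrite -ball_normE/=.
  have -> : x - y = (x - x') + (x' - y) by rewrite addrA subrK.
  rewrite (le_lt_trans (ler_normD _ _))// [ltRHS]splitr ltrD//.
  exact: lt_trans x'y dr.
have -> : f x' - f y = - (f x - f x') + (f x - f y).
  by rewrite opprB addrA subrK.
by rewrite (le_lt_trans (ler_normD _ _))// normrN [ltRHS]splitr ltrD.
Qed.

Lemma continuous_compact_bounded (K : set 'rV[R]_n) (f : 'rV[R]_n -> R) :
  compact K -> (forall x, K x -> {for x, continuous f}) ->
  exists M : R, forall x, K x -> `|f x| <= M.
Proof.
move=> cK cf; have cf' : {within K, continuous f}.
  by apply: continuous_in_subspaceT => x /[1!inE]; exact: cf.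
have [M [Mr HM]] := compact_bounded (continuous_compact cf' cK).
exists (`|M| + 1) => x Kx; apply: (HM (`|M| + 1)).
  by rewrite (le_lt_trans (ler_norm _))// ltrDl.
by exists x.
Qed.

End RowVectors.

(** * Counting grid points in thin slabs *)

(** Grid points [m] are sorted into [N ^ n] cells by [Q]. Inside one cell the
    coordinates of two grid points differ by less than [W], so residues mod [W]
    determine them, and the coordinate of index [j] is a function of the others.
    A cell thus contains at most [W ^ n.-1] grid points. The residue at index [j]
    being free, it is used to store an extra element of ['I_W]; this turns the
    count into one injection and avoids the exponent [n.-1]. *)
Lemma counting_separated_cells (n M N W : nat)
    (Q : {ffun 'I_n -> 'I_M} -> {ffun 'I_n -> 'I_N})
    (j : {ffun 'I_n -> 'I_N} -> 'I_n) : (0 < W)%N ->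
    (forall m m' i, Q m = Q m' -> (m i < m' i + W)%N) ->
    (forall m m', Q m = Q m' -> (forall i, i != j (Q m) -> m i = m' i) ->
      m = m') ->
  (M ^ n * W <= N ^ n * W ^ n)%N.
Proof.
move=> W0 QW Qj.
pose F (z : {ffun 'I_n -> 'I_M} * 'I_W) :
    {ffun 'I_n -> 'I_N} * {ffun 'I_n -> 'I_W} :=
  (Q z.1, [ffun i => if i == j (Q z.1) then z.2
                     else Ordinal (ltn_pmod (z.1 i) W0)]).
have F_inj : injective F.
  move=> [m w] [m' w'] [] /= QE; rewrite -QE => /ffunP E.
  have mE : m = m'.
    apply: Qj => // i ij; have := E i; rewrite !ffunE (negPf ij) => -[] mi.
    have := QW m m' i QE; have := QW m' m i (esym QE) => h1 h2.
    apply/val_inj => /=; have [le|/ltnW le] := leqP (m i) (m' i).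
      move: (subnK le) => /esym e.
      have : (m' i - m i < W)%N by lia.
      have /eqP : m' i = m i %[mod W] by [].
      by rewrite (eqn_mod_dvd W le) => /dvdnP[[|k] hk]; lia.
    have : (m i - m' i < W)%N by lia.
    have /eqP : m i = m' i %[mod W] by [].
    by rewrite (eqn_mod_dvd W le) => /dvdnP[[|k] hk]; lia.
  by congr pair => //; have := E (j (Q m)); rewrite !ffunE eqxx.
have := leq_card F F_inj.
by rewrite !card_prod !card_ffun !card_ord.
Qed.

Section Slab.
Context {R : realType} {n : nat}.
Implicit Types x y p c : 'rV[R]_n.

Lemma interval_subdivision (L : R) (N : nat) (u : R) : (0 < N)%N ->
  0 <= u <= L ->
  exists k : 'I_N, k%:R * (L / N%:R) <= u <= k.+1%:R * (L / N%:R).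
Proof.
move=> N0 /andP[u0 uL].
have NR : 0 < N%:R :> R by rewrite ltr0n.
have L0 : 0 <= L by exact: le_trans uL.
(* The right end point belongs to the last cell, which is closed. *)
have [->|Ln0] := eqVneq u L.
  have lastN : (N.-1 < N)%N by rewrite prednK.
  exists (Ordinal lastN) => /=.
  rewrite prednK// [N%:R * _]mulrC divfK ?lt0r_neq0// lexx andbT.
  by rewrite mulrA ler_pdivrMr// mulrC ler_wpM2l// ler_nat leq_pred.
have Lu : u < L by rewrite lt_neqAle Ln0.
have Lp : 0 < L by exact: le_lt_trans Lu.
have h0 : 0 < L / N%:R by rewrite divr_gt0.
have /andP[k1 k2] := truncn_itv (divr_ge0 u0 (ltW h0)).
have kN : (Num.truncn (u / (L / N%:R)) < N)%N.
  rewrite -(ltr_nat R) (le_lt_trans k1)// ltr_pdivrMr//.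
  by rewrite mulrC divfK ?lt0r_neq0.
exists (Ordinal kN) => /=.
by rewrite -ler_pdivlMr// k1/= -ler_pdivrMr// ltW.
Qed.

Lemma ball_subdivision c (r : R) (N : nat) : (0 < N)%N ->
  exists Q : 'rV[R]_n -> {ffun 'I_n -> 'I_N},
    forall x y, `|x - c| <= r -> `|y - c| <= r -> Q x = Q y ->
    `|x - y| <= 2 * r / N%:R.
Proof.
move=> N0.
have /choice[k Hk] (u : R) : exists k : 'I_N, 0 <= u <= 2 * r ->
    k%:R * (2 * r / N%:R) <= u <= k.+1%:R * (2 * r / N%:R).
  have [/(interval_subdivision N0)[k ?]|_] := boolP (0 <= u <= 2 * r).
    by exists k.
  by exists (Ordinal N0).
exists (fun x => [ffun i => k (x 0 i - c 0 i + r)]) => x y xc yc /ffunP E.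
have r0 : 0 <= r by exact: le_trans xc.
apply: rV_norm_le => [|i]; first by rewrite divr_ge0 ?mulr_ge0.
have bnd z : `|z - c| <= r -> 0 <= z 0 i - c 0 i + r <= 2 * r.
  move=> /(le_trans (rV_coord_le _ i)); rewrite !mxE ler_norml.
  by move=> /andP[? ?]; apply/andP; split; lra.
have := E i; rewrite !ffunE => kE.
have := Hk _ (bnd _ xc); have := Hk _ (bnd _ yc); rewrite kE !mxE.
set K := k _; rewrite -(natr1 K) mulrDl mul1r.
set h := 2 * r / N%:R; move: (K%:R * h) => kh /andP[? ?] /andP[? ?].
by rewrite ler_norml; apply/andP; split; lra.
Qed.

(** At a point [p] where the derivative of [g] is singular, some [v != 0] is
    orthogonal to its range, so that [f := \sum_i v 0 i *: g i] has small partial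
    derivatives near [p] and hence small increments. If the [g i] agree at [x] and
    [y] except for an index [j] at which [v] is largest, then the increment of [f]
    is [v 0 j] times that of [g j], and the size of [v] cancels: the values of [g]
    near [p] fill only a thin slab, a graph over the other coordinates. *)
Lemma critical_slab (g : 'I_n -> 'rV[R]_n -> R) c p (r h w : R) : 0 <= w ->
    \det (\matrix_(i, j) 'D_('e_i) (g j) p) = 0 ->
    (forall i j y, `|y - c| <= r -> `|y - p| <= h -> derivable (g j) y 'e_i /\
       `|'D_('e_i) (g j) y - 'D_('e_i) (g j) p| <= w) ->
  exists j, forall x y, `|x - c| <= r -> `|y - c| <= r ->
    `|x - p| <= h -> `|y - p| <= h ->
    (forall i, i != j -> g i x = g i y) ->
    `|g j x - g j y| <= n%:R * (n%:R * w) * `|x - y|.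
Proof.
move=> w0; rewrite -det_tr => /eqP/det0P[v v0 vA] Hg.
have [j vj] : exists j, `|v| = `|v 0 j|.
  have v1 : mx_norm v != 0 by move: v0; rewrite -normr_eq0.
  have [[i j] /= E] := mx_norm_neq0 v1.
  by exists j; rewrite -(ord1 i).
have vj0 : 0 < `|v 0 j| by rewrite -vj normr_gt0.
exists j => x y xc yc xp yp gxy.
pose f := \sum_(i < n) (v 0 i *: g i).
have fE z : f z = \sum_(i < n) v 0 i * g i z by rewrite /f fct_sumE.
have : `|f x - f y| <= n%:R * (n%:R * (`|v 0 j| * w)) * `|x - y|.
  apply: increment_box; first by rewrite !mulr_ge0.
  move=> z i xyz.
  have zc := box_ball xc yc xyz; have zp := box_ball xp yp xyz.
  have df k : derivable (v 0 k *: g k) z 'e_i.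
    by apply: derivableZ; have [] := Hg i k z zc zp.
  split; first exact: derivable_sum.
  rewrite derive_sum//.
  have -> : \sum_(k < n) 'D_('e_i) (v 0 k *: g k) z =
      \sum_(k < n) v 0 k * ('D_('e_i) (g k) z - 'D_('e_i) (g k) p).
    transitivity (\sum_(k < n) v 0 k * 'D_('e_i) (g k) z
      - (v *m (\matrix_(i, j) 'D_('e_i) (g j) p)^T) 0 i).
      rewrite vA mxE subr0; apply: eq_bigr => k _.
      by rewrite deriveZ//; have [] := Hg i k z zc zp.
    rewrite mxE -sumrB; apply: eq_bigr => k _.
    by rewrite !mxE mulrBr.
  apply: (le_trans (ler_norm_sum _ _ _)).
  apply: (@le_trans _ _ (\sum_(k < n) (`|v 0 j| * w))).
    apply: ler_sum => k _; rewrite normrM ler_pM//.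
      by rewrite -vj rV_coord_le.
    by have [] := Hg i k z zc zp.
  by rewrite sumr_const card_ord mulr_natl.
have -> : f x - f y = v 0 j * (g j x - g j y).
  rewrite !fE -sumrB (bigD1 j)//= big1 ?addr0 ?mulrBr// => i ij.
  by rewrite gxy// subrr.
rewrite normrM.
have -> : n%:R * (n%:R * (`|v 0 j| * w)) * `|x - y| =
  `|v 0 j| * (n%:R * (n%:R * w) * `|x - y|) by ring.
by rewrite ler_pM2l.
Qed.

End Slab.

(** * Critical values of a C^1 map on a cube *)

Lemma cvg_det (R : realType) (n : nat) (T : Type) (F : set_system T)
    {FF : Filter F} (A : T -> 'M[R]_n) (L : 'M[R]_n) :
  (forall i j, A x i j @[x --> F] --> L i j) ->
  \det (A x) @[x --> F] --> \det L.
Proof.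
move=> AL; rewrite /determinant.
apply: cvg_big => [|s _]; first exact: add_continuous.
apply: cvgMl_tmp.
by apply: cvg_big => [|i _]; [exact: mul_continuous|exact: AL].
Qed.

Section CriticalValues.
Context {R : realType} {n : nat}.
Variables (g : 'I_n.+1 -> 'rV[R]_n.+1 -> R) (c : 'rV[R]_n.+1) (r : R).
Let B := [set x | `|x - c| <= r].
Let J x : 'M[R]_n.+1 := \matrix_(i, j) 'D_('e_i) (g j) x.
Let G x : 'rV[R]_n.+1 := \row_j g j x.

Hypothesis dg : forall i j x, B x -> derivable (g j) x 'e_i.
Hypothesis cg : forall j x, B x -> {for x, continuous (g j)}.
Hypothesis cdg : forall i j x, B x -> {for x, continuous ('D_('e_i) (g j))}.

Lemma compact_B : compact B.
Proof.
apply: bounded_closed_compact.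
  exists (r + `|c|); split; first exact: num_real.
  move=> M rM x xc; apply: le_trans (ltW rM).
  by rewrite -[x](subrK c) (le_trans (ler_normD _ _))// lerD2r.
rewrite [B](_ : _ = (fun x => `|x - c|) @^-1` [set u | u <= r])//.
apply: closed_comp; last exact: closed_le.
move=> x _; apply: continuous_comp; last exact: norm_continuous.
by apply: continuousB => //; exact: cst_continuous.
Qed.

Lemma lipschitz_B : exists2 C : nat, (0 < C)%N &
  forall j x y, B x -> B y -> `|g j x - g j y| <= C%:R * `|x - y|.
Proof.
have /choice[M HM] (ij : 'I_n.+1 * 'I_n.+1) : exists M : R, forall x, B x ->
    `|'D_('e_ij.1) (g ij.2) x| <= M.
  by apply: continuous_compact_bounded; [exact: compact_B|move=> x; exact: cdg].
pose D := \sum_ij `|M ij|.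
have MD i j x : B x -> `|'D_('e_i) (g j) x| <= D.
  move=> Bx; rewrite (le_trans (HM (i, j) x Bx))// (le_trans (ler_norm _))//.
  by rewrite /D (bigD1 (i, j))//= lerDl sumr_ge0.
have D0 : 0 <= D by rewrite sumr_ge0.
exists (Num.truncn (n.+1%:R * D)).+1 => // j x y Bx By.
have := @increment_box _ _ (g j) x y D D0.
move=> /(_ _)/le_trans; apply.
  move=> z i /(box_ball Bx By) Bz; split; [exact: dg|exact: MD].
by rewrite ler_wpM2r// ltW// truncnS_gt.
Qed.

Lemma partials_unif_continuous (w : R) : 0 < w -> exists2 d, 0 < d &
  forall i j x y, B x -> `|x - y| < d ->
    `|'D_('e_i) (g j) x - 'D_('e_i) (g j) y| < w.
Proof.
move=> w0.
have : \forall d \near 0^'+, forall ij x, B x -> forall y, `|x - y| < d ->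
    `|'D_('e_ij.1) (g ij.2) x - 'D_('e_ij.1) (g ij.2) y| < w.
  apply: filter_forall => ij.
  apply: unif_continuous_compact => //; first exact: compact_B.
  by move=> x Bx; exact: cdg.
move=> H; near (0 : R)^'+ => d; exists d => //.
move=> i j x y Bx xy.
have : forall ij x, B x -> forall y, `|x - y| < d ->
    `|'D_('e_ij.1) (g ij.2) x - 'D_('e_ij.1) (g ij.2) y| < w by near: d.
by move=> /(_ (i, j) x Bx y xy).
Unshelve. all: by end_near. Qed.

Definition critical_values : set 'rV[R]_n.+1 :=
  G @` [set x | B x /\ \det (J x) = 0].

Lemma G_continuous x : B x -> {for x, continuous G}.
Proof.
move=> Bx; apply/(@cvgrPdist_le _ _ _ _ (nbhs_filter x)) => e e0.
have : \forall y \near x, forall j, `|g j x - g j y| <= e.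
  apply: (@filter_forall _ _ _ _ (nbhs_filter x)) => j.
  by have /cvgrPdist_le/(_ _ e0) := @cg j _ Bx.
apply: filterS => y Hy; apply: rV_norm_le => [|j]; first exact: ltW.
by rewrite !mxE.
Qed.

Lemma det_J_continuous x : B x -> {for x, continuous (fun y => \det (J y))}.
Proof.
move=> Bx; apply: (@cvg_det _ _ _ _ (nbhs_filter x)) => i j.
under eq_cvg do rewrite mxE.
by rewrite mxE; exact: cdg.
Qed.

(** The critical points form a closed subset of the compact set [B], so that
    their image is compact. *)
Lemma critical_values_closed : closed critical_values.
Proof.
apply: compact_closed; first exact: norm_hausdorff.
apply: continuous_compact.
  by apply: continuous_in_subspaceT => x /[1!inE] -[Bx _]; exact: G_continuous.
apply: (subclosed_compact _ compact_B); last by move=> x [].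
move=> x clx.
have Bx : B x.
  apply: (compact_closed (@norm_hausdorff _ _) compact_B).
  by move=> U /clx[y [[By _] Uy]]; exists y.
split=> //; apply: contrapT => /eqP dx0.
have e0 : 0 < `|\det (J x)| by rewrite normr_gt0.
have /cvgrPdist_lt/(_ _ e0)/clx[y [[By dy]]] := det_J_continuous Bx.
by rewrite /= dy subr0 ltxx.
Qed.

(** Suppose that the critical values fill a ball of radius [e] around [a0]. Cut
    the cube [B] into [N ^ n.+1] cells of side [h := 2 * r / N], with [N := s * t],
    and consider the grid of mesh [delta := h / q] with [M := q * t] points per
    coordinate. As [s] exceeds [4 * r / e], the grid stays within [e / 2] of [a0]
    whatever [t] is; hence each grid point [a m] is the value at a critical point
    [x m]. Values on one cell vary by at most [C * h], that is [C * q] mesh sizes,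
    and for [t] large (depending on [q]) they lie in a slab thinner than the
    mesh. Counting yields
    [(q * t) ^ n.+1 <= (s * t) ^ n.+1 * (C * q).+1 ^ n]. Here [t] cancels, and
    comparing the powers of [q] bounds [q] by [s ^ n.+1 * (2 * C) ^ n], which is
    absurd since [s] and [C] are fixed before [q]. *)
Lemma critical_values_codense : 0 < r -> dense (~` critical_values).
Proof.
move=> r0; apply: contrapT => /denseNE[U [[a0 [oU Ua0]] UV]].
have [e /= e0 He] : exists2 e : R, 0 < e & ball a0 e `<=` U.
  by apply/nbhs_ballP; exact: open_nbhs_nbhs.
have {}UV a : `|a - a0| < e -> critical_values a.
  move=> ae; apply: contrapT => na.
  have : (U `&` ~` critical_values) a.
    by split=> //; apply: He; rewrite -ball_normE/= distrC.
  by rewrite UV.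
have [C C0 HC] := lipschitz_B.
have [s s0 se] : exists2 s : nat, (0 < s)%N & 4 * r / e < s%:R.
  by exists (Num.truncn (4 * r / e)).+1; rewrite // truncnS_gt.
have [q Sq] : exists q, (s ^ n.+1 * (2 * C) ^ n < q)%N.
  by exists (s ^ n.+1 * (2 * C) ^ n).+1.
have qN0 : (0 < q)%N by exact: leq_ltn_trans Sq.
pose W := (C * q).+1.
(* This tolerance makes the slabs half a mesh thick. *)
pose w : R := (2 * n.+1%:R * n.+1%:R * q%:R)^-1.
have q0 : 0 < q%:R :> R by rewrite ltr0n.
have sR : 0 < s%:R :> R by rewrite ltr0n.
have w0 : 0 < w by rewrite invr_gt0 !mulr_gt0.
have [d d0 Hd] := partials_unif_continuous w0.
have [t t0 td] : exists2 t : nat, (0 < t)%N & 2 * r / d < t%:R.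
  by exists (Num.truncn (2 * r / d)).+1; rewrite // truncnS_gt.
have tR : 0 < t%:R :> R by rewrite ltr0n.
pose N := (s * t)%N; pose M := (q * t)%N.
have N0 : (0 < N)%N by rewrite muln_gt0 s0.
pose h : R := 2 * r / N%:R.
have h0 : 0 < h by rewrite divr_gt0 ?mulr_gt0 ?ltr0n.
have hd : h < d.
  rewrite /h ltr_pdivrMr ?ltr0n// [d * _]mulrC -ltr_pdivrMr//.
  by apply: lt_le_trans td _; rewrite ler_nat leq_pmull.
pose delta : R := h / q%:R.
have delta0 : 0 < delta by rewrite divr_gt0.
have deltaM : M%:R * delta <= e / 2.
  have -> : M%:R * delta = 2 * r / s%:R.
    by rewrite /delta /h /M /N !natrM; field; rewrite !lt0r_neq0.
  rewrite ler_pdivrMr//; move: se; rewrite ltr_pdivrMr// => ?; lra.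
have [Q HQ] := ball_subdivision c r N0.
pose a (m : {ffun 'I_n.+1 -> 'I_M}) : 'rV[R]_n.+1 :=
  a0 + \row_i ((m i)%:R * delta).
have /choice[x Hx] m : exists x, (B x /\ \det (J x) = 0) /\ G x = a m.
  have /UV[x Hx xm] : `|a m - a0| < e; last by exists x.
  rewrite /a addrAC subrr add0r (@le_lt_trans _ _ (e / 2))//; last by lra.
  apply: rV_norm_le => [|i]; first by lra.
  rewrite mxE ger0_norm; last exact: mulr_ge0 (ler0n _ _) (ltW delta0).
  by apply: le_trans deltaM; rewrite ler_pM2r// ler_nat ltnW.
have gx m i : g i (x m) = a0 0 i + (m i)%:R * delta.
  by have [_ /rowP/(_ i)] := Hx m; rewrite !mxE.
have gxB m m' i : g i (x m) - g i (x m') = ((m i)%:R - (m' i)%:R) * delta.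
  by rewrite !gx; ring.
have Bx m : B (x m) by have [[]] := Hx m.
have dx m : \det (J (x m)) = 0 by have [[]] := Hx m.
have xQ m m' : Q (x m) = Q (x m') -> `|x m - x m'| <= h by apply: HQ; exact: Bx.
have /choice[j Hj] (k : {ffun 'I_n.+1 -> 'I_N}) : exists j, forall m m',
    Q (x m) = k -> Q (x m') = k ->
    (forall i, i != j -> g i (x m) = g i (x m')) ->
    `|g j (x m) - g j (x m')| <= n.+1%:R * (n.+1%:R * w) * h.
  have [[m mk]|nk] := pselect (exists m, Q (x m) = k); last first.
    by exists ord0 => m m' mk; exfalso; apply: nk; exists m.
  have [j Hj] : exists j, forall y z, B y -> B z ->
      `|y - x m| <= h -> `|z - x m| <= h ->
      (forall i, i != j -> g i y = g i z) ->
      `|g j y - g j z| <= n.+1%:R * (n.+1%:R * w) * `|y - z|.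
    apply: critical_slab; [exact: ltW|exact: dx|].
    move=> i j z Bz zx; split; first exact: dg.
    by rewrite ltW// Hd// (le_lt_trans zx).
  exists j => m1 m2 m1k m2k gE.
  apply: (le_trans (Hj _ _ (Bx m1) (Bx m2) _ _ gE)).
  - by rewrite xQ// m1k mk.
  - by rewrite xQ// m2k mk.
  - by rewrite ler_wpM2l ?xQ ?m1k ?m2k// !mulr_ge0// ltW.
have count : (M ^ n.+1 * W <= N ^ n.+1 * W ^ n.+1)%N.
  apply: (@counting_separated_cells _ _ _ _ (fun m => Q (x m)) j);
    [by []|move=> m m' i mm'|move=> m m' mm'].
    have := HC i (x m) (x m') (Bx m) (Bx m').
    move=> /le_trans/(_ (ler_wpM2l (ler0n _ _) (xQ _ _ mm'))).
    rewrite gxB normrM [`|delta|]gtr0_norm// /delta mulrA ler_pdivrMr// mulrAC.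
    rewrite ler_pM2r// => /(le_trans (ler_norm _)).
    by rewrite lerBlDr -natrM -natrD ler_nat addnC -ltnS -addnS.
  move=> mE; apply/ffunP => i; have [->|/mE//] := eqVneq i (j (Q (x m))).
  have gE i' : i' != j (Q (x m)) -> g i' (x m) = g i' (x m').
    by move=> /mE E; rewrite !gx E.
  have := Hj _ m m' erefl (esym mm') gE.
  set k := j _; rewrite gxB normrM [`|delta|]gtr0_norm//.
  have -> : n.+1%:R * (n.+1%:R * w) * h = 2^-1 * delta.
    by rewrite /w /delta; field; rewrite (lt0r_neq0 q0) nat1r pnatr_eq0.
  rewrite ler_pM2r// ler_norml => /andP[h1 h2].
  have le_k : (m k < (m' k).+1)%N by rewrite -(ltr_nat R) -natr1; lra.
  have ge_k : (m' k < (m k).+1)%N by rewrite -(ltr_nat R) -natr1; lra.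
  by apply/val_inj/eqP; rewrite eqn_leq -ltnS le_k -ltnS ge_k.
move: count; rewrite /M /N !expnMn -mulnA [(t ^ _ * W)%N]mulnC mulnA.
rewrite -[X in (_ <= X)%N]mulnA [(t ^ _ * W ^ _)%N]mulnC mulnA.
rewrite leq_pmul2r ?expn_gt0 ?t0//.
rewrite [(W ^ _)%N]expnSr mulnA leq_pmul2r//.
apply/negP; rewrite -ltnNge.
have WC : (W <= 2 * C * q)%N.
  by rewrite /W -mulnA mul2n -addnn -addn1 leq_add2l muln_gt0 C0.
apply: (@leq_ltn_trans (s ^ n.+1 * (2 * C * q) ^ n)).
  by rewrite leq_mul2l; apply/orP; right; case: (n) => // k; rewrite leq_exp2r.
by rewrite expnMn mulnA [(q ^ n.+1)%N]expnS ltn_pmul2r ?expn_gt0 ?qN0.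
Qed.
End CriticalValues.

(** * Regular values on an open set *)

Lemma rational_ball (R : realType) (n : nat) (X : set 'rV[R]_n) x :
  open X -> X x -> exists (c : 'rV[rat]_n) (k : nat),
    `|x - map_mx ratr c| <= k.+1%:R^-1 /\
    [set y | `|y - map_mx ratr c| <= k.+1%:R^-1] `<=` X.
Proof.
move=> oX Xx; have [e /= e0 He] : exists2 e : R, 0 < e & ball x e `<=` X.
  by apply/nbhs_ballP; exact: open_nbhs_nbhs.
pose k := Num.truncn (2 / e); pose d : R := k.+1%:R^-1.
have d0 : 0 < d by rewrite invr_gt0.
have de : 2 * d < e.
  by rewrite ltr_pdivrMr// mulrC -ltr_pdivrMr// truncnS_gt.
have /choice[q Hq] i : exists q : rat, x 0 i - d < ratr q < x 0 i + d.
  have /rat_in_itvoo[q] : x 0 i - d < x 0 i + d by lra.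
  by rewrite in_itv/=; exists q.
exists (\row_i q i), k; have xc : `|x - map_mx ratr (\row_i q i)| <= d.
  apply: rV_norm_le => [|i]; first exact: ltW.
  by have /andP[? ?] := Hq i; rewrite !mxE ler_norml; apply/andP; split; lra.
split=> // y /= yc; apply: He; rewrite -ball_normE/=.
rewrite -[x](subrK (map_mx ratr (\row_i q i))) -addrA.
rewrite (le_lt_trans (ler_normD _ _))// [X in _ + X]distrC.
apply: le_lt_trans de; rewrite mulrDl mul1r.
by apply: lerD.
Qed.

(** Joins completeness and norm into one structure on matrices, the form in which
    Baire's theorem asks for them. *)
HB.instance Definition _ (R : realType) (m n : nat) := Complete.on 'M[R]_(m, n).

(** An open set is the union of the countably many closed cubes with rational
    center and radius [k.+1%:R^-1] that it contains. By Baire's theorem the dense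
    open complements of the critical values on these cubes have a dense
    intersection. *)
Lemma regular_values_dense (R : realType) (n : nat) (X : set 'rV[R]_n.+1)
    (g : 'I_n.+1 -> 'rV[R]_n.+1 -> R) : open X ->
    (forall i j x, X x -> derivable (g j) x 'e_i) ->
    (forall j x, X x -> {for x, continuous (g j)}) ->
    (forall i j x, X x -> {for x, continuous ('D_('e_i) (g j))}) ->
  dense [set a | forall x, X x -> \row_j g j x = a ->
    \det (\matrix_(i, j) 'D_('e_i) (g j) x) != 0].
Proof.
move=> oX dg cg cdg.
pose cball (z : 'rV[rat]_n.+1 * nat) : set 'rV[R]_n.+1 :=
  [set y | `|y - map_mx ratr z.1| <= z.2.+1%:R^-1].
pose F (m : nat) : set 'rV[R]_n.+1 :=
  if unpickle m is Some z then
    if `[< cball z `<=` X >]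
    then ~` critical_values g (map_mx ratr z.1) z.2.+1%:R^-1 else setT
  else setT.
have dF : dense (\bigcap_m F m).
  apply: Baire => m; rewrite /F; case: unpickle => [z|]; last first.
    by split; [exact: openT|move=> U [u Uu] _; exists u].
  case: asboolP => zX; last first.
    by split; [exact: openT|move=> U [u Uu] _; exists u].
  split.
    apply: closed_openC; apply: critical_values_closed.
    - by move=> j x /zX; exact: cg.
    - by move=> i j x /zX; exact: cdg.
  apply: critical_values_codense => //.
  - by move=> i j x /zX; exact: dg.
  - by move=> i j x /zX; exact: cdg.
move=> U U0 oU; have [a [Ua Fa]] := dF U U0 oU.
exists a; split=> // x Xx xa; apply/negP => /eqP dx.
have [c [k [xc cX]]] := rational_ball oX Xx.
have := Fa (pickle (c, k)) I; rewrite /F pickleK.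
by rewrite asboolT//; apply; exists x.
Qed.

(** * Adding a linear form in C^k of the closure *)

Section Restriction.
Context {R : realType} {n : nat}.
Variable X : set 'rV[R]_n.
Hypothesis oX : open X.
Implicit Types (f g : 'rV[R]_n -> R).

Let eqX_near f g x : (forall y, X y -> f y = g y) -> X x ->
  \forall y \near x, f y = g y.
Proof.
move=> fg Xx; have : nbhs x X by exact: open_nbhs_nbhs.
by apply: filterS => y; exact: fg.
Qed.

Lemma eq_pderivs f g (s : seq 'I_n) : (forall x, X x -> f x = g x) ->
  forall x, X x -> pderivs s f x = pderivs s g x.
Proof.
move=> fg; elim: s => //= i s ih x Xx.
exact: (near_eq_derive _ (eqX_near ih Xx)).
Qed.

Lemma eq_Ck_closure k f g : (forall x, X x -> f x = g x) ->
  Ck_closure X k f -> Ck_closure X k g.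
Proof.
move=> fg [[df cf] ef]; split; first split.
- move=> s i sk x Xx.
  exact: (near_eq_derivable (eqX_near (eq_pderivs s fg) Xx) (df s i sk x Xx)).
- move=> s sk x Xx; have fgs := eq_pderivs s fg.
  rewrite /prop_for /continuous_at -(fgs _ Xx).
  by apply: cvg_trans (cf s sk x Xx); exact: (near_eq_cvg (eqX_near fgs Xx)).
- move=> s sk; have [h ch hE] := ef s sk; exists h => // x Xx.
  by rewrite hE// (eq_pderivs s fg).
Qed.

End Restriction.

Section LinearForm.
Context {R : realType} {n : nat}.
Implicit Types (a x v : 'rV[R]_n).

Definition linear_form a x : R := \sum_i a 0 i * x 0 i.

Lemma linear_form_continuous a : continuous (linear_form a).
Proof.
move=> x; apply: (@cvg_big _ _ _ _ _ _ _ (nbhs x) _ _ _ (nbhs_filter x)).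
  exact: add_continuous.
by move=> i _; apply: cvgMl_tmp; exact: coord_continuous.
Qed.

Lemma linear_form_is_derive a x v :
  is_derive x v (linear_form a) (linear_form a v).
Proof.
have E : (fun h : R =>
    h^-1 *: ((linear_form a \o shift x) (h *: v) - linear_form a x)) @ 0^'
    --> linear_form a v.
  apply: cvg_near_cst; near=> h.
  have h0 : h != 0 by near: h; exact: nbhs_dnbhs_neq.
  rewrite /linear_form /= -sumrB scaler_sumr; apply: eq_bigr => i _.
  by rewrite !mxE /GRing.scale/=; field.
by split; [apply/cvg_ex; exists (linear_form a v)|exact: cvg_lim].
Unshelve. all: by end_near. Qed.

Lemma pderiv_linear_form a i : pderiv i (linear_form a) = cst (a 0 i).
Proof.
apply/funext => x; rewrite /pderiv.
have /@derive_val -> := linear_form_is_derive a x 'e_i.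
rewrite /linear_form (bigD1 i)//= big1 ?mxE ?eqxx ?mulr1 ?addr0// => j ji.
by rewrite mxE (negPf ji) andbF mulr0.
Qed.

Lemma pderivs_linear_form a (s : seq 'I_n) :
  pderivs s (linear_form a) = linear_form a \/
  exists c, pderivs s (linear_form a) = cst c.
Proof.
elim: s => [|i s [/= ->|[c /= ->]]]; [by left| |].
  by right; exists (a 0 i); rewrite pderiv_linear_form.
by right; exists 0; apply/funext => x; rewrite /pderiv derive_cst.
Qed.

Lemma linear_form_Ck_closure X k a : Ck_closure X k (linear_form a).
Proof.
have cs s : continuous (pderivs s (linear_form a)).
  have [->|[c ->]] := pderivs_linear_form a s.
    exact: linear_form_continuous.
  by move=> x; exact: cst_continuous.
split; first split.
- move=> s i _ x _; have [->|[c ->]] := pderivs_linear_form a s.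
    by have [] := linear_form_is_derive a x 'e_i.
  exact: derivable_cst.
- by move=> s _ x _; exact: cs.
- move=> s _; exists (pderivs s (linear_form a)) => //.
  exact: continuous_subspaceT.
Qed.

End LinearForm.

Section Perturbation.
Context {R : realType} {n : nat}.
Variables (X : set 'rV[R]_n) (k : nat) (oX : open X) (bX : bounded_set X).
Local Notation ty := (Ck_space k oX bX).
Implicit Types (a b : 'rV[R]_n).

(** The representative in [Ck_space] of a linear form on [X]: elements vanish
    outside [X]. *)
Definition cut_linear_form a x : R := if `[< X x >] then linear_form a x else 0.

Lemma cut_linear_formE a x : X x -> cut_linear_form a x = linear_form a x.
Proof. by move=> Xx; rewrite /cut_linear_form asboolT. Qed.

Lemma cut_linear_form_Ck a : cut_linear_form a \in Ck_space_pred k oX.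
Proof.
apply/asboolP; split=> [|x nXx]; last by rewrite /cut_linear_form asboolF.
apply: (eq_Ck_closure oX _ (linear_form_Ck_closure X k a)) => x Xx.
by rewrite cut_linear_formE.
Qed.

Definition linear_Ck a : ty := CkSpace bX (cut_linear_form_Ck a).

Lemma linear_Ck_is_linear : linear linear_Ck.
Proof.
move=> t a b; apply/val_inj/funext => x.
change (cut_linear_form (t *: a + b) x =
  t * cut_linear_form a x + cut_linear_form b x).
rewrite /cut_linear_form; case: asboolP => _; last by rewrite mulr0 addr0.
rewrite /linear_form mulr_sumr -big_split/=; apply: eq_bigr => i _.
by rewrite !mxE mulrDl mulrA.
Qed.

HB.instance Definition _ :=
  GRing.isLinear.Build R 'rV[R]_n ty _ linear_Ck linear_Ck_is_linear.

(** Linear forms make up a finite-dimensional space, so that the perturbation is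
    small in the C^k norm as soon as its coefficients are. *)
Lemma linear_Ck_small (e : R) : 0 < e ->
  exists2 d : R, 0 < d & forall a, `|a| < d -> `|linear_Ck a| < e.
Proof.
move=> e0; pose M := \sum_i `|linear_Ck (delta_mx 0 i)|.
have M0 : 0 <= M by rewrite sumr_ge0.
have M1 : 0 < M + 1 by rewrite ltr_wpDl.
exists (e / (M + 1)) => [|a]; first by rewrite divr_gt0.
rewrite ltr_pdivlMr// => ae; apply: le_lt_trans ae.
rewrite {1}[a]row_sum_delta linear_sum/=.
apply: (le_trans (ler_norm_sum _ _ _)).
apply: (@le_trans _ _ (`|a| * M)); last by rewrite ler_wpM2l// lerDl.
rewrite mulr_sumr; apply: ler_sum => i _.
by rewrite linearZ/= normrZ ler_wpM2r// rV_coord_le.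
Qed.

Lemma pderivs_perturb (f : ty) a (s : seq 'I_n) x : (size s <= k)%N -> X x ->
  pderivs s (f + linear_Ck a) x = pderivs s f x + pderivs s (linear_form a) x.
Proof.
move=> sk Xx; have -> : (f + linear_Ck a : 'rV[R]_n -> R) =
  1 *: (f : 'rV[R]_n -> R) + cut_linear_form a by rewrite scale1r.
have [Cf _] := Ck_spaceP f; have [Ca _] := Ck_spaceP (linear_Ck a).
rewrite (pderivs_lin oX 1 Cf Ca)// mul1r; congr (_ + _).
by apply: (eq_pderivs oX) => // y; exact: cut_linear_formE.
Qed.

(** Gradients are shifted by [a] and Hessians unchanged, so that the critical
    points of the perturbed function are the points where [f] has gradient [- a]. *)
Lemma perturb_morse (f : ty) a : (2 <= k)%N ->
    (forall x, X x -> gradient f x = - a -> \det (hessian f x) != 0) ->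
  morse X (f + linear_Ck a).
Proof.
move=> k2 reg; have [[df cf] _] := Ck_spaceP (f + linear_Ck a).
split; first split.
- by move=> s i s2; apply: df; exact: leq_trans k2.
- by move=> s s2; apply: cf; exact: leq_trans k2.
move=> p Xp gp; rewrite unitmxE unitfE.
have -> : hessian (f + linear_Ck a) p = hessian f p.
  apply/matrixP => i j; rewrite !mxE.
  rewrite [LHS](pderivs_perturb f a (s := [:: i; j]) k2 Xp) /=.
  by rewrite pderiv_linear_form /pderiv derive_cst addr0.
apply: reg => //; apply/rowP => i.
have /rowP/(_ i) := gp; rewrite !mxE.
have := pderivs_perturb f a (s := [:: i]) (ltnW k2) Xp.
rewrite /= pderiv_linear_form => -> /eqP.
by rewrite addr_eq0 => /eqP.
Qed.

End Perturbation.

(** * Density of Morse functions *)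

Theorem theorem2p6 (R : realType) (n k : nat) (X : set 'rV[R]_n)
    (oX : open X) (bX : bounded_set X) (hk : (n.+1 <= k)%N) :
  dense (morse_functions k oX bX).
Proof.
case: n X oX bX hk => [|n] X oX bX hk U [f Uf] oU.
  (* In dimension 0 every Hessian is the empty matrix, of determinant 1. *)
  exists f; split=> //; have [[_ cf] _] := Ck_spaceP f.
  split; last by move=> p _ _; rewrite unitmxE det_mx00 unitr1.
  split=> [s [[]]//|[|[[]]//]] _ x Xx.
  exact: (cf [::]).
have [e /= e0 He] : exists2 e : R, 0 < e & ball f e `<=` U.
  by apply/nbhs_ballP; exact: open_nbhs_nbhs.
have [d d0 Hd] := linear_Ck_small k oX bX e0.
have [[df cf] _] := Ck_spaceP f.
have k2 : (2 <= k)%N by exact: leq_trans hk.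
have k1 : (1 <= k)%N by exact: ltnW.
have [a [a0 reg]] : ball (0 : 'rV[R]_n.+1) d `&`
    [set a | forall x, X x -> gradient f x = a -> \det (hessian f x) != 0]
    !=set0.
  apply: (regular_values_dense (g := fun j => pderiv j f) oX).
  - by move=> i j x; exact: (df [:: j]).
  - by move=> j x; exact: (cf [:: j]).
  - by move=> i j x; exact: (cf [:: i; j]).
  - by exists 0; exact: ballxx.
  - exact: ball_open.
move: a0; rewrite -ball_normE/= sub0r normrN => ad.
exists (f + linear_Ck k oX bX (- a)); split; last first.
  by apply: perturb_morse => // x Xx; rewrite opprK; exact: reg.
apply: He; rewrite -ball_normE/= opprD addNKr normrN.
by apply: Hd; rewrite normrN.
Qed.
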